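(* For all integers $n < 2^{250}$ and all integers $w$ with $0 \le w \le n$, there is no nontrivial $1$-perfect code in $J(n,w)$.
   Context: For integers $0 \le w \le n$, the Johnson graph $J(n,w)$ has as vertex set $V^n_w$, the set of all $w$-element subsets of $\{1,2,\ldots,n\}$; two vertices are adjacent if their intersection has size $w-1$. The distance between two $w$-sets is half the size of their symmetric difference. The $1$-sphere of a vertex is the set of all $w$-sets within distance at most $1$ of it. A code $C \subseteq V^n_w$ is called $1$-perfect if the $1$-spheres of the codewords of $C$ form a partition of $V^n_w$. A $1$-perfect code is called trivial if it consists of a single codeword, or if $n=2w$ and it consists of a pair of disjoint $w$-subsets; otherwise it is nontrivial. *)

(* Defs.v *)
From mathcomp Require Export all_boot.

Set Implicit Arguments.
Unset Strict Implicit.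
Unset Printing Implicit Defensive.

(* The ground set {1, ..., n} is represented by 'I_n = {0, ..., n-1}. *)
Definition johnson_vertices (n w : nat) : {set {set 'I_n}} :=
  [set A : {set 'I_n} | #|A| == w].

Definition johnson_adj (n w : nat) : rel {set 'I_n} :=
  fun A B => [&& A \in johnson_vertices n w, B \in johnson_vertices n w
               & #|A :&: B|.+1 == w].

Definition symdiff (n : nat) (A B : {set 'I_n}) : {set 'I_n} :=
  (A :\: B) :|: (B :\: A).

(* The halving is exact when #|A| = #|B|: see johnson_distE. *)
Definition johnson_dist (n : nat) (A B : {set 'I_n}) : nat :=
  #|symdiff A B|./2.

Lemma johnson_distE (n w : nat) (A B : {set 'I_n}) :
  A \in johnson_vertices n w -> B \in johnson_vertices n w ->
  (johnson_dist A B).*2 = #|symdiff A B| /\ johnson_dist A B + #|A :&: B| = w.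
Proof.
rewrite !inE => /eqP cA /eqP cB.
have dAB : [disjoint A :\: B & B :\: A].
  by rewrite -setI_eq0; apply/eqP/setP => x; rewrite !inE;
    case: (x \in A); case: (x \in B).
have e : #|A :\: B| = #|B :\: A|.
  apply: (@addnI #|A :&: B|).
  by rewrite cardsID [A :&: B]setIC cardsID cA cB.
have c : #|symdiff A B| = #|A :\: B|.*2.
  have := leq_card_setU (A :\: B) (B :\: A); rewrite dAB => -[_ /eqP].
  by rewrite -e addnn.
by rewrite /johnson_dist c doubleK -cA -(cardsID B A) addnC.
Qed.

Lemma johnson_dist1 (n w : nat) (A B : {set 'I_n}) :
  A \in johnson_vertices n w -> B \in johnson_vertices n w ->
  johnson_adj w A B = (johnson_dist A B == 1).
Proof.
move=> vA vB; have [_ e] := johnson_distE vA vB.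
by rewrite /johnson_adj vA vB /= -[X in _ == X]e -add1n eqn_add2r eq_sym.
Qed.

Definition sphere1 (n w : nat) (A : {set 'I_n}) : {set {set 'I_n}} :=
  [set B in johnson_vertices n w | johnson_dist A B <= 1].

(* The partition is that of the indexed family (sphere1 w A), A in C: distinct
   codewords must have disjoint spheres.  Using finset's [partition] on the set
   of spheres would identify codewords with equal spheres (e.g. for w = 1).
   Non-emptiness of the blocks is automatic, since A \in sphere1 w A. *)
Definition perfect1_code (n w : nat) (C : {set {set 'I_n}}) : Prop :=
  [/\ C \subset johnson_vertices n w,
      {in C &, forall A B, A != B -> [disjoint sphere1 w A & sphere1 w B]}
    & \bigcup_(A in C) sphere1 w A = johnson_vertices n w].

Definition trivial_code (n w : nat) (C : {set {set 'I_n}}) : Prop :=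
  #|C| = 1 \/
  n = 2 * w /\
  exists A B : {set 'I_n},
    [/\ A \in johnson_vertices n w, B \in johnson_vertices n w,
        A != B, [disjoint A & B] & C = [set A; B]].

(* Main.v *)
Require Import Defs.
From mathcomp Require Import all_boot zify.
From Stdlib Require Import NArith.

Set Implicit Arguments.
Unset Strict Implicit.
Unset Printing Implicit Defensive.

(** A 1-sphere of J(n,w) has Phi = 1 + w (n - w) elements.  Counting the
    vertices above an i-set I through the unique sphere that contains each of
    them relates the number of codewords above I to the same numbers for the
    subsets I - z; the coefficient of the new unknown is Phi - i (n + 1 - i).
    Hence, as long as no j <= i is a root of j (n + 1 - j) = Phi, the codewords
    are equidistributed: Phi times the number of codewords that contain I and
    miss a disjoint set J is 'C(n - |I| - |J|, w - |I|) when |I| + |J| <= i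
    ([card_containing], [card_between]).  If there is no root in 1..w, then
    i = w gives Phi = 1 and the graph has one vertex.  Otherwise let A be the
    least root and B = n + 1 - A the other one.  If A = 1, then w <= 1 or
    n - w <= 1, any two vertices are at distance at most 1, and the code has one
    word.  If A > 1, put w = A + d and n - w = A + e; one finds

      A = d e + 1,   B = (d + 1) (e + 1) + 1,   Phi = A B,

    and equidistribution up to A - 1 makes all the binomials 'C(B, s) with
    d < s < B - e divisible by A ([perfect_code_parameters]).  By the
    symmetry of the problem one may suppose d <= e, and by that of the binomials
    the divisibility extends to d < s < B - d.

    Now let p be a prime divisor of A and p^r the largest power of p that is at
    most B.  By Kummer's theorem p does not divide 'C(B, p^r), so p^r falls in
    the interval [B - d, B], which is shorter than the square root of its members
    ([prime_power_near]).  In the same way A is squarefree.  As A < B - d, all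
    these exponents are at least 2, and they are pairwise coprime, two k-th powers
    being too far apart to share the interval ([near_powers_coprime]).  Moreover
    p divides d p^r - (d + 1) A, which is less than d^2 + d, and positive if d >= 2
    ([A_prime_bound]).

    Let sigma be the sum of the 1/r over the primes p dividing A.  Since A is the
    product of those p and A < p^r <= B, we get sigma < 1 and A <= B^sigma; and
    B / A <= (1 + 1/d)^2.  So the defect 1 - sigma is tiny, at most
    4 / (d log2 B) ([exponent_defect]), whereas d is large,
    (d + 1)^(2 r) >= B for each of the r ([exponent_d_bound]).  For
    B < 2^250 this can be refuted by a short computation, because the exponents
    are few: at the sizes considered, no powers of two distinct primes below 2^m
    are close enough to share the interval, so all exponents but the largest are
    at most log2 B / m.  The ranges 2^14 <= B < 2^27 (with m = 6) and
    2^27 <= B < 2^250 (with m = 10) leave some thousands of sets of coprime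
    exponents, and none of them meets both bounds; for B < 2^14 the pairs of close
    prime powers are inspected one by one.
    All this needs d >= 2.  When d = 1, the powers p^r all equal 2 A, which forces
    A = 2 and e = 1: this is J(6,3), where the code is a pair of disjoint
    triples. *)

(** * Counting the vertices above a set *)

Lemma card_supersets (T : finType) (I : {set T}) w : #|I| <= w ->
  #|[set B : {set T} | (I \subset B) && (#|B| == w)]| = 'C(#|T| - #|I|, w - #|I|).
Proof.
move=> Iw; have -> : #|T| - #|I| = #|~: I| by rewrite -(cardsC I) addKn.
rewrite -cards_draws; set draws := [set _ | _ & _ == w - _].
have <- : #|[set I :|: D | D in draws]| = #|draws|.
  apply: card_in_imset => D E; rewrite !inE => /andP[DI _] /andP[EI _] eDE.
  have eI (F : {set T}) : F \subset ~: I -> (I :|: F) :\: I = F.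
    by move=> FI; rewrite setDUl setDv set0U; apply/setDidPl; rewrite disjoints_subset.
  by rewrite -(eI D DI) -(eI E EI) eDE.
apply: eq_card => B; rewrite inE; apply/andP/imsetP.
  case=> IB /eqP Bw; exists (B :\: I).
    by rewrite inE subDset setUCr subsetT cardsD (setIidPr IB) Bw eqxx.
  by rewrite setDE setUIr setUCr setIT; apply/esym/setUidPr.
case=> D; rewrite inE => /andP[DI /eqP Dc] ->; split; first exact: subsetUl.
have dID : [disjoint I & D] by rewrite disjoint_sym disjoints_subset.
move: dID; rewrite -leq_card_setU => /eqP ->; rewrite Dc; lia.
Qed.

Lemma exists_subset_card (T : finType) (S : {set T}) k : k <= #|S| ->
  exists2 A : {set T}, A \subset S & #|A| = k.
Proof.
rewrite -bin_gt0 -cards_draws card_gt0 => /set0Pn[A].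
by rewrite inE => /andP[AS /eqP Ak]; exists A.
Qed.

Lemma sum_indicator (T : finType) (S : {set T}) (P : pred T) :
  \sum_(x in S) (P x : nat) = #|[set x in S | P x]|.
Proof.
rewrite -sum1_card [RHS](eq_bigl (fun x => (x \in S) && P x)); last by move=> x; rewrite inE.
by rewrite big_mkcondr.
Qed.

Section Spheres.
Variables (n w : nat).
Implicit Types (A B c I : {set 'I_n}).

(** Distance at most 1 means losing at most one element of c. *)
Lemma mem_sphere1 c B : #|c| = w ->
  (B \in sphere1 w c) = (#|B| == w) && (w <= #|c :&: B|.+1).
Proof.
move=> cw; rewrite inE inE; case: eqP => //= Bw.
have [|| _ h] := @johnson_distE n w c B; rewrite ?inE ?cw ?Bw ?eqxx //.
by rewrite -h addnC -[X in _ = (_ <= X)]addn1 leq_add2l.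
Qed.

(** The neighbours of c, indexed by the pair (element lost, element gained). *)
Definition exchange c (xy : 'I_n * 'I_n) := xy.2 |: (c :\ xy.1).

Lemma exchangeI_in c : {in setX c (~: c) &, injective (exchange c)}.
Proof.
move=> [x y] [x' y']; rewrite !inE /= => /andP[xc yc] /andP[x'c y'c].
move=> /setP e.
have := e y; rewrite !inE eqxx /= (negbTE yc) andbF orbF => /esym/eqP ->.
have := e x; rewrite !inE eqxx /= xc andbT => /esym.
case: (x =P y) => [exy|_]; first by rewrite exy (negbTE yc) in xc.
case: (x =P y') => [exy|_]; first by rewrite exy (negbTE y'c) in xc.
by move=> /= /negbFE/eqP ->.
Qed.

Lemma sphere1_exchange c : #|c| = w ->
  sphere1 w c = c |: exchange c @: setX c (~: c).
Proof.
move=> cw; apply/setP => B; rewrite (mem_sphere1 _ cw) inE in_set1.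
apply/andP/orP => [[/eqP Bw cB]|[/eqP ->|/imsetP[[x y]]]]; last 1 first.
- rewrite !inE /= => /andP[xc yc] ->.
  have xy : x != y by apply: contraNneq yc => <-.
  have c1 : #|exchange c (x, y)| = w.
    rewrite /exchange /= cardsU1 !inE (negbTE yc) andbF /=.
    by rewrite -cw (cardsD1 x c) xc.
  rewrite c1 eqxx; split=> //.
  have -> : c :&: exchange c (x, y) = c :\ x.
    apply/setP=> z; rewrite !inE; case: (z =P y) => [->|] /=; first by rewrite (negbTE yc) andbF.
    by case: (z \in c); rewrite ?andbF ?andbT.
  by rewrite -cw (cardsD1 x c) xc.
- have := cardsID B c; have := cardsID c B; rewrite setIC cw Bw => h1 h2.
  have [k0|k1] : #|c :\: B| = 0 \/ #|c :\: B| = 1 by lia.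
    left; rewrite eqEcard cw Bw leqnn andbT.
    have/eqP : #|B :\: c| = 0 by lia.
    by rewrite cards_eq0 setD_eq0.
  right; have/eqP/cards1P[x ex] := k1.
  have/cards1P[y ey] : #|B :\: c| == 1 by apply/eqP; lia.
  have /setDP[xc xB] : x \in c :\: B by rewrite ex set11.
  have /setDP[yB yc] : y \in B :\: c by rewrite ey set11.
  apply/imsetP; exists (x, y); first by rewrite !inE xc yc.
  apply/setP=> z; rewrite !inE /=.
  have := congr1 (fun S : {set _} => z \in S) ex.
  have := congr1 (fun S : {set _} => z \in S) ey; rewrite !inE => <- <-.
  by case: (z \in c); case: (z \in B).
- by rewrite setIid cw eqxx.
Qed.

Lemma subset_exchange c I x y : x \in c -> y \notin c ->
  (I \subset exchange c (x, y)) = (x \notin I) && (I :\: c \subset [set y]).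
Proof.
move=> xc yc; have xy : x != y by apply: contraNneq yc => <-.
apply/subsetP/andP => [h|[xI /subsetP h] z zI].
  split; first by apply/negP=> /h; rewrite !inE eqxx /= orbF (negbTE xy).
  apply/subsetP=> z; rewrite !inE => /andP[zc /h]; rewrite !inE (negbTE zc) andbF orbF //.
rewrite !inE /=; have := h z; rewrite !inE zI andbT.
case zc : (z \in c) => /=; last by move=> ->.
by move=> _; rewrite andbT; apply/orP; right; apply: contraNneq xI => <-.
Qed.

(** A neighbour of c contains I when the element lost is outside I and the
    element gained covers I - c.  So c and its neighbours can contain I only if
    I - c has at most one element: if it is empty, any element outside c may be
    gained, and if it is a singleton, the element gained is determined. *)
Lemma card_sphere1_superset c I : #|c| = w -> #|I| <= w ->
  #|[set B in sphere1 w c | I \subset B]| =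
  (I \subset c) * (1 + (w - #|I|) * (n - w)) + (#|I :\: c| == 1) * (w - #|I|).+1.
Proof.
move=> cw Iw; pose E := [set xy in setX c (~: c) | I \subset exchange c xy].
have cn : ~~ [exists xy in setX c (~: c), exchange c xy == c].
  apply/negP => /existsP[[x y]]; rewrite !inE /= => /andP[/andP[xc yc] /eqP e].
  by have := setU11 y (c :\ x); rewrite -/(exchange c (x, y)) e (negbTE yc).
have -> : [set B in sphere1 w c | I \subset B] =
   [set B in [set c] | I \subset B] :|: exchange c @: E.
  rewrite sphere1_exchange //; apply/setP=> B; rewrite !inE andb_orl; congr (_ || _).
  apply/andP/imsetP => [[/imsetP[xy xyc ->] IB]|[xy]].
    by exists xy => //; rewrite inE xyc.
  by rewrite inE => /andP[xyc ?] ->; split=> //; apply: imset_f.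
have -> : #|[set B in [set c] | I \subset B] :|: exchange c @: E| =
   (I \subset c) + #|E|.
  transitivity (#|[set B in [set c] | I \subset B]| + #|exchange c @: E|).
    apply/eqP; rewrite (leq_card_setU _ _).2; apply/pred0P => B; rewrite !inE /=.
    apply/negP => /andP[/andP[/eqP -> _] /imsetP[xy]]; rewrite inE => /andP[xyc _] e.
    by case/negP: cn; apply/existsP; exists xy; rewrite xyc -e eqxx.
  rewrite card_in_imset; last first.
    move=> ? ?; rewrite inE => /andP[h1 _]; rewrite inE => /andP[h2 _].
    exact: exchangeI_in.
  congr (_ + _); case Ic : (I \subset c).
    rewrite (_ : [set _ in _ | _] = [set c]) ?cards1 //.
    by apply/setP=> B; rewrite !inE; case: eqP => // ->.
  rewrite (_ : [set _ in _ | _] = set0) ?cards0 //.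
  by apply/setP=> B; rewrite !inE; case: eqP => // ->; rewrite Ic.
have cC : #|~: c| = n - w by rewrite -cw -[X in X - _]card_ord -(cardsC c) addKn.
case Ic : (I \subset c).
  have e0 : I :\: c = set0 by apply/eqP; rewrite setD_eq0.
  rewrite e0 cards0 /= addn0 mul1n; congr (_ + _).
  have -> : E = setX (c :\: I) (~: c).
    apply/setP=> -[x y]; rewrite !inE /=.
    case xc: (x \in c); case yc : (y \in c) => //=; rewrite ?andbF //.
    by rewrite subset_exchange ?xc ?yc // e0 sub0set !andbT.
  by rewrite cardsX cC cardsD (setIidPr Ic) cw.
rewrite mul0n !add0n.
case: (boolP (#|I :\: c| == 1)) => h.
  have/cards1P[z ez] := h.
  have /setDP[zI zc] : z \in I :\: c by rewrite ez set11.
  have -> : E = setX (c :\: I) [set z].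
    apply/setP=> -[x y]; rewrite !inE /=.
    case: (boolP (y \in c)) => yc.
      rewrite andbF /= andbC; case: eqP => // yz; by rewrite yz (negbTE zc) in yc.
    case: (boolP (x \in c)) => xc //=; last by rewrite andbF.
    by rewrite subset_exchange // ez sub1set inE andbT (eq_sym z).
  rewrite cardsX cards1 muln1 mul1n cardsD cw.
  by have := cardsID c I; rewrite (eqP h) setIC; lia.
rewrite mul0n; apply/eqP; rewrite cards_eq0 -subset0; apply/subsetP => -[x y].
rewrite !inE /= => /andP[/andP[xc yc]].
rewrite subset_exchange // => /andP[_ /subset_leq_card].
rewrite cards1 leq_eqVlt (negbTE h) /= ltnS leqn0.
by rewrite cards_eq0 setD_eq0 Ic.
Qed.

End Spheres.

(** * Equidistribution of the codewords *)

Lemma cross_eq a b c d : a != b -> a * c + b * d = a * d + b * c -> c = d.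
Proof. nia. Qed.

Section PerfectCode.
Variables (n w : nat) (C : {set {set 'I_n}}).
Hypotheses (wn : w <= n) (perfC : perfect1_code w C).
Implicit Types (A B c I J : {set 'I_n}).

Local Notation u := (n - w).
Local Notation Phi := (1 + w * u).

Lemma codeword_card c : c \in C -> #|c| = w.
Proof. by case: perfC => /subsetP sC _ _ /sC; rewrite inE => /eqP. Qed.

Lemma perfect_unique_codeword B : #|B| = w ->
  #|[set c in C | B \in sphere1 w c]| = 1.
Proof.
move=> Bw; case: perfC => _ dC covC.
have : B \in johnson_vertices n w by rewrite inE Bw.
rewrite -covC => /bigcupP[c cC Bc]; apply/eqP/cards1P; exists c.
apply/setP=> c'; rewrite inE in_set1; apply/andP/eqP => [[c'C Bc']|->]; last by [].
apply/eqP; apply: contraTT Bc' => /(dC _ _ c'C cC)/pred0P/(_ B) /=.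
by rewrite Bc andbT => ->.
Qed.

Definition nb_containing I := #|[set c in C | I \subset c]|.

(** A codeword above I - z either contains z or misses exactly z from I. *)
Lemma nb_missing_one I z : z \in I ->
  #|[set c in C | I :\: c == [set z]]| + nb_containing I = nb_containing (I :\ z).
Proof.
move=> zI; rewrite /nb_containing addnC.
rewrite -[RHS](cardsID [set c : {set 'I_n} | z \in c]).
congr (_ + _); apply: eq_card => c; rewrite !inE; case: (c \in C); rewrite ?andbF //=.
  by rewrite -{1}(setD1K zI) subUset sub1set andbC.
apply/eqP/andP => [e|[zc /subsetP h]].
  split; first by have /setDP[_] : z \in I :\: c by rewrite e set11.
  apply/subsetP => x; rewrite !inE => /andP[xz xI]; apply: contraNT xz => xc.
  by rewrite -in_set1 -e inE xc.
apply/setP => x; rewrite !inE; case: (x =P z) => [->|/eqP xz]; first by rewrite zc.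
case xI : (x \in I); last by rewrite andbF.
by rewrite h // !inE xz.
Qed.

Lemma sum_nb_containing_setD1 I :
  #|[set c in C | #|I :\: c| == 1]| + #|I| * nb_containing I =
  \sum_(z in I) nb_containing (I :\ z).
Proof.
rewrite -(eq_bigr _ (nb_missing_one (I := I))) big_split /= sum_nat_const; congr (_ + _).
under eq_bigr => z _ do rewrite -sum_indicator.
rewrite exchange_big /= -sum_indicator; apply: eq_bigr => c _.
rewrite sum_indicator; case: (boolP (_ == 1)) => [/cards1P[z ez]|h].
  apply/esym/eqP/cards1P; exists z; apply/setP => y; rewrite !inE ez.
  apply/andP/eqP => [[_ /eqP/set1_inj]|->] //; split; last by [].
  by have /setDP[] : z \in I :\: c by rewrite ez set11.
apply/esym/eqP; rewrite cards_eq0 -subset0; apply/subsetP => y; rewrite !inE => /andP[_ /eqP e].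
by rewrite e cards1 in h.
Qed.

(** Both sides count the w-sets above I, the right-hand side according to the
    codeword whose sphere contains them. *)
Lemma containing_recurrence I : #|I| <= w ->
  'C(n - #|I|, w - #|I|) = nb_containing I * (1 + (w - #|I|) * u)
    + #|[set c in C | #|I :\: c| == 1]| * (w - #|I|).+1.
Proof.
move=> Iw; have := card_supersets Iw; rewrite card_ord => <-.
have -> : #|[set B : {set 'I_n} | (I \subset B) && (#|B| == w)]| =
    \sum_(c in C) #|[set B in sphere1 w c | I \subset B]|.
  rewrite -sum1_card (eq_bigr (fun B => \sum_(c in C) (B \in sphere1 w c : nat))).
    rewrite exchange_big /=; apply: eq_bigr => c _.
    rewrite sum_indicator; apply: eq_card => B; rewrite 6!inE.
    by rewrite inE; case: (I \subset B); case: (#|B| == w); rewrite ?andbF ?andbT.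
  by move=> B; rewrite inE => /andP[_ /eqP Bw]; rewrite sum_indicator perfect_unique_codeword.
rewrite (eq_bigr _ (fun c cC => card_sphere1_superset (codeword_card cC) Iw)).
by rewrite big_split /= -!big_distrl /= !sum_indicator.
Qed.

(** The levels j at which the recurrence loses its unknown.  As Phi - j (n + 1 - j)
    = 1 + (w - j) (n - w - j) - j, they are the j for which -1 is the j-th
    eigenvalue of the Johnson graph. *)
Definition degenerate j := Phi == j * (n.+1 - j).

(** Induction on i.  Eliminating the codewords that miss one element of I between
    [containing_recurrence] and [sum_nb_containing_setD1] leaves
    (Phi - i (n + 1 - i)) (Phi x - 'C(n - i, w - i)) = 0 for the number x of
    codewords above I; [cross_eq] is the cancellation, with both signs
    of the first factor covered. *)
Lemma card_containing i : i <= w -> (forall j, 0 < j <= i -> ~~ degenerate j) ->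
  forall I, #|I| = i -> Phi * nb_containing I = 'C(n - i, w - i).
Proof.
elim: i => [_ _ I I0|i IH iw nr I Ii].
  have := @containing_recurrence I; rewrite I0 => /(_ isT).
  have/cards0_eq -> := I0; rewrite (_ : [set c in C | _] = set0) ?cards0 ?subn0 => [->|]; first by lia.
  by apply/setP=> c; rewrite !inE set0D cards0 andbF.
have := @containing_recurrence I; rewrite Ii => /(_ iw).
have := sum_nb_containing_setD1 I; rewrite Ii.
move: #|_| => y.
have hz z : z \in I -> Phi * nb_containing (I :\ z) = 'C(n - i, w - i).
  move=> zI; apply: IH; first exact: ltnW.
    by move=> j /andP[j0 ji]; apply: nr; rewrite j0 leqW.
  by have := cardsD1 z I; rewrite zI Ii => -[].
move=> /(congr1 (muln Phi)); rewrite big_distrr /= (eq_bigr _ hz) sum_nat_const Ii.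
have := mul_bin_diag (n - i) (w - i.+1).
rewrite (_ : (n - i).-1 = n - i.+1); last by lia.
rewrite (_ : (w - i.+1).+1 = w - i); last by lia.
have := nr i.+1; rewrite leqnn /degenerate => /(_ isT).
move: (nb_containing I) 'C(n - i, w - i) 'C(n - i.+1, w - i.+1) => x D0 D1.
have [m ew] : exists m, w = i.+1 + m by exists (w - i.+1); lia.
have [k en] : exists k, n = w + k by exists (n - w); lia.
have -> : n - i = m.+1 + k by lia.
have -> : w - i = m.+1 by lia.
have -> : w - i.+1 = m by lia.
have -> : n.+1 - i.+1 = m.+1 + k by lia.
have -> : n - w = k by lia.
rewrite ew => neq hD hy hD1.
apply: (@cross_eq (1 + m * k) (m.+1 * i.+1)); first by lia.
have := congr1 (muln (1 + (i.+1 + m) * k)) hD1.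
have := congr1 (muln m.+1) hy; have := congr1 (muln i.+1) hD; lia.
Qed.

Definition nb_between I J := #|[set c in C | (I \subset c) && [disjoint J & c]]|.

(** Pascal's rule: a codeword that contains I and misses J - y either misses y
    or contains y as well. *)
Lemma card_between t I J : t <= w -> (forall j, 0 < j <= t -> ~~ degenerate j) ->
  [disjoint I & J] -> #|I| + #|J| <= t ->
  Phi * nb_between I J = 'C(n - #|I| - #|J|, w - #|I|).
Proof.
move=> tw nr; move Ej : #|J| => j; elim: j I J Ej => [|j IH] I J Jj dIJ ijt.
  have/cards0_eq -> := Jj; rewrite subn0.
  rewrite -(card_containing _ _ (erefl #|I|)); first last.
  - by move=> k /andP[k0 ki]; apply: nr; lia.
  - lia.
  congr (_ * _); apply: eq_card => c; rewrite !inE.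
  by rewrite -setI_eq0 set0I eqxx andbT.
have [y yJ] : exists y, y \in J by apply/set0Pn; rewrite -card_gt0 Jj.
have J'j : #|J :\ y| = j by have := cardsD1 y J; rewrite yJ Jj => -[].
have yI : y \notin I by apply: contraTN dIJ => yI; apply/pred0Pn; exists y; rewrite /= yI.
have dIJ' : [disjoint I & J :\ y] by apply: disjointWr dIJ; apply: subD1set.
have h0 := IH I (J :\ y) J'j dIJ' ltac:(lia).
have I'i : #|y |: I| = #|I|.+1 by rewrite cardsU1 yI.
have dI'J' : [disjoint y |: I & J :\ y].
  rewrite disjoint_sym disjoints_subset; apply/subsetP => z; rewrite !inE negb_or => /andP[-> zJ] /=.
  by apply: contraTN dIJ => zI; apply/pred0Pn; exists z; rewrite /= zI.
have := IH (y |: I) (J :\ y) J'j dI'J' ltac:(lia); rewrite I'i => h1.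
have e : nb_between I (J :\ y) = nb_between I J + nb_between (y |: I) (J :\ y).
  rewrite {1}/nb_between -(cardsID [set c : {set 'I_n} | y \in c]) addnC.
  congr (_ + _); apply: eq_card => c; rewrite !inE.
    case: (c \in C); rewrite ?andbF //=; case: (I \subset c); rewrite ?andbF //=.
    rewrite !disjoints_subset -{2}(setD1K yJ) subUset sub1set inE; by case: (y \in c).
  rewrite subUset sub1set; case: (y \in c); rewrite ?andbF ?andbT //=.
have := binS (n - #|I| - j.+1) (w - #|I|.+1).
rewrite (_ : (n - #|I| - j.+1).+1 = n - #|I| - j); last by lia.
rewrite (_ : (w - #|I|.+1).+1 = w - #|I|); last by lia.
rewrite (_ : n - #|I|.+1 - j = n - #|I| - j.+1) in h1; last by lia.
move: h0; rewrite e mulnDr h1; lia.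
Qed.

(** Then any two vertices are at distance at most 1. *)
Lemma perfect_code_single : w <= 1 \/ u <= 1 -> #|C| = 1.
Proof.
move=> small; have [B _ Bw] : exists2 B : {set 'I_n}, B \subset setT & #|B| = w.
  by apply: exists_subset_card; rewrite cardsT card_ord.
rewrite -(perfect_unique_codeword Bw); apply: eq_card => c; rewrite inE.
case cC : (c \in C) => //=; apply/esym; rewrite (mem_sphere1 _ (codeword_card cC)) Bw eqxx /=.
have -> // : w <= #|c :&: B|.+1.
have := cardsUI c B; rewrite (codeword_card cC) Bw.
have : #|c :|: B| <= n by rewrite -[leqRHS]card_ord max_card.
move: wn small; lia.
Qed.

(** Here d e + 1 is the least degenerate level A and (d + 1) (e + 1) + 1 is
    B = n + 1 - A.  The binomials 'C(B, s) count, up to the factor Phi = A B,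
    the codewords that contain a given set of size w - s and miss another one
    of size A - 1 - (w - s); the sizes of the two sets add up to A - 1, the last
    level below A, so that all these counts are over n - (A - 1) = B points.  The
    final clause, for sets of size at most one, identifies the code when
    d = e = 1. *)
Lemma perfect_code_parameters : #|C| = 1 \/
  exists d e, [/\ 0 < d, 0 < e, w = d * e + 1 + d, n = w + (d * e + 1 + e) &
    (forall s, d < s <= w -> (d * e + 1) %| 'C(d.+1 * e.+1 + 1, s))
    /\ forall I, #|I| <= 1 -> Phi * nb_containing I = 'C(n - #|I|, w - #|I|)].
Proof.
case: (boolP [exists j : 'I_w.+1, (0 < j) && degenerate j]) => [|nr]; last first.
  left; apply: perfect_code_single.
  have nr' j : 0 < j <= w -> ~~ degenerate j.
    move=> /andP[j0 jw]; apply: contra nr => rj; apply/existsP; exists (Ordinal (jw : j < w.+1)).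
    by rewrite j0.
  have [I _ Iw] : exists2 I : {set 'I_n}, I \subset setT & #|I| = w.
    by apply: exists_subset_card; rewrite cardsT card_ord.
  have := card_containing (leqnn w) nr' Iw; rewrite subnn bin0 => /eqP; rewrite muln_eq1.
  move=> /andP[/eqP h _]; have/eqP : w * u = 0 by lia.
  by rewrite muln_eq0 => /orP[]/eqP ->; [left|right].
move=> /existsP ex0; have {ex0} ex : exists j, [&& 0 < j, j <= w & degenerate j].
  by have [j /andP[j0 rj]] := ex0; exists j; rewrite j0 rj andbT; exact: (ltn_ord j).
case: (ex_minnP ex) => A /and3P[A0 Aw rA] minA.
have nr j : 0 < j <= A.-1 -> ~~ degenerate j.
  move=> /andP[j0 jA]; apply/negP => rj; have := minA j; rewrite j0 rj andbT /=; lia.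
have [d ed] : exists d, w = A + d by exists (w - A); lia.
have [k ek] : exists k, n = w + k by exists (n - w); lia.
have uk : u = k by lia.
have rE : 1 + (A + d) * k = A * (d + k).+1.
  move: rA; rewrite /degenerate uk (_ : n.+1 - A = (d + k).+1); last by lia.
  by rewrite ed => /eqP.
have [A1|A1] := leqP A 1.
  left; apply: perfect_code_single; rewrite uk; have A_1 : A = 1 by lia.
  rewrite A_1 in rE ed; have/eqP : d * k = d * 1 by lia.
  by rewrite eqn_mul2l => /orP[]/eqP ?; lia.
right; have Ak : A <= k.
  rewrite leqNgt; apply/negP => kA; have [m em] : exists m, A = k + 1 + m by exists (A - k - 1); lia.
  by rewrite em in rE A1; lia.
have [e ee] : exists e, k = A + e by exists (k - A); lia.
have eA : A = d * e + 1 by rewrite ee in rE; lia.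
have [d0 e0] : 0 < d /\ 0 < e by apply/andP; rewrite -muln_gt0; lia.
have design (I J : {set 'I_n}) := card_between (I := I) (J := J) (leq_trans (leq_pred A) Aw) nr.
have PhiE : Phi = A * (d.+1 * e.+1 + 1) by rewrite uk ed ee eA; lia.
exists d, e; rewrite -eA; split; [by []|by []|by []|by lia|split].
  move=> s /andP[ds sw].
  have [I _ Iw] : exists2 I : {set 'I_n}, I \subset setT & #|I| = w - s.
    by apply: exists_subset_card; rewrite cardsT card_ord; lia.
  have [J JI Jj] : exists2 J : {set 'I_n}, J \subset ~: I & #|J| = A.-1 - (w - s).
    apply: exists_subset_card; have := cardsC I; rewrite card_ord; lia.
  have := design I J; rewrite Iw Jj disjoint_sym disjoints_subset => /(_ JI) h.
  have {h} := h ltac:(lia); rewrite PhiE.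
  rewrite (_ : n - (w - s) - (A.-1 - (w - s)) = d.+1 * e.+1 + 1); last by lia.
  by rewrite subKn // => <-; rewrite -mulnA dvdn_mulr.
move=> I I1; apply: (card_containing (i := #|I|)) => //; first by lia.
by move=> j /andP[j0 j1]; apply: nr; lia.
Qed.
End PerfectCode.

(** * Binomials divisible by A and prime powers close to B *)

Lemma sum_divn_expn_widen p m N : prime p -> m <= N ->
  \sum_(1 <= k < N.+1) m %/ p ^ k = logn p m`!.
Proof.
move=> pp mN; rewrite logn_fact // (big_cat_nat (n := m.+1)) //=.
rewrite [X in _ + X]big1_seq ?addn0 // => k /andP[_]; rewrite mem_index_iota => /andP[mk _].
by rewrite divn_small // (leq_trans mk) // ltnW // ltn_expl ?prime_gt1.
Qed.

(** Kummer's theorem in the form needed here: in the addition of s and N - s in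
    base p, no carry leaves the last k digits, which are zero in s, nor the
    positions above r, where N has no digit. *)
Lemma logn_bin_le p N s k r : prime p -> N < p ^ r.+1 -> s <= N -> p ^ k %| s ->
  logn p 'C(N, s) <= r - k.
Proof.
move=> pp Nr sN ks.
have := congr1 (logn p) (bin_fact sN).
rewrite !lognM ?muln_gt0 ?fact_gt0 ?bin_gt0 //.
rewrite -!(sum_divn_expn_widen (N := N)) ?leq_subr //.
rewrite -big_split /= => h.
suff : \sum_(1 <= j < N.+1) N %/ p ^ j <=
   \sum_(1 <= j < N.+1) (s %/ p ^ j + (N - s) %/ p ^ j) + (r - k).
  by rewrite -h; lia.
have bound : \sum_(1 <= j < N.+1) (k < j <= r : nat) <= r - k.
  rewrite -big_mkcond /= sum1_count -size_filter -(size_iota k.+1 (r - k)).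
  apply: uniq_leq_size; first by rewrite filter_uniq // iota_uniq.
  by move=> j; rewrite mem_filter !mem_iota; lia.
apply: leq_trans (leq_add (leqnn _) bound); rewrite -big_split /=.
apply: leq_sum => j _.
have pj : 0 < p ^ j by rewrite expn_gt0 prime_gt0.
have [jk|kj] := leqP j k.
  have pjs : p ^ j %| s by apply: dvdn_trans ks; apply: dvdn_exp2l.
  by rewrite -{1}(subnKC sN) divnDl // leq_addr.
have [jr|rj] /= := leqP j r; last first.
  by rewrite divn_small // (leq_trans Nr) // leq_exp2l ?prime_gt1.
rewrite -{1}(subnKC sN) divnD //; case: (_ <= _ %% _ + _) => /=; lia.
Qed.

Lemma trunc_log_prime_bounds p B : prime p -> 0 < B ->
  p ^ trunc_log p B <= B < p ^ (trunc_log p B).+1.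
Proof. by move=> pp B0; apply: trunc_log_bounds; rewrite ?prime_gt1. Qed.

Section BinomialsDivisible.
Variables (d B M : nat).
Hypotheses (d_gt0 : 0 < d) (dB : d * d + 2 * d < B).
Hypothesis divM : forall s, d < s < B - d -> M %| 'C(B, s).
Variable p : nat.
Hypotheses (pp : prime p) (pB : p <= B) (pM : p %| M).

Lemma exponent_gt0 : 0 < trunc_log p B.
Proof. by apply: trunc_log_max; rewrite ?prime_gt1 // expn1. Qed.

(** If the largest power q of p up to B were in (d, B - d), then 'C(B, q) would
    have to be divisible by p, against Kummer's theorem.  If it were at most d,
    then B < p q <= d^2. *)
Lemma prime_power_near : B - d <= p ^ trunc_log p B.
Proof.
have /andP[prB Bpr] := trunc_log_prime_bounds pp (leq_ltn_trans (leq0n _) dB).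
rewrite leqNgt; apply/negP => prd.
have [prd'|dpr] := leqP (p ^ trunc_log p B) d; last first.
  have := dvdn_trans pM (divM (s := p ^ trunc_log p B) ltac:(by rewrite dpr)).
  have : 0 < 'C(B, p ^ trunc_log p B) by rewrite bin_gt0.
  move=> C0 pC; have := logn_bin_le pp Bpr prB (dvdnn _); rewrite subnn leqNgt => /negP; apply.
  by rewrite logn_gt0 mem_primes pp C0.
have pr1 : p <= p ^ trunc_log p B by rewrite -{1}(expn1 p) leq_exp2l ?exponent_gt0 // prime_gt1.
move: Bpr; rewrite expnS; have := leq_mul (leq_trans pr1 prd') prd'; lia.
Qed.

(** Kummer's theorem leaves room for one carry only when s is a multiple of
    p^(r-1), and p^(r-1) itself lies in (d, B - d) if r > 1, since its square is
    at least p^r.  If r = 1, then d + 1 will do. *)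
Lemma logn_le1 : logn p M <= 1.
Proof.
have /andP[prB Bpr] := trunc_log_prime_bounds pp (leq_ltn_trans (leq0n _) dB).
have prd := prime_power_near; have r0 := exponent_gt0.
suff [s ds ps] : exists2 s, d < s < B - d & p ^ (trunc_log p B).-1 %| s \/ trunc_log p B = 1.
  have sB : s <= B by lia.
  have C0 : 0 < 'C(B, s) by rewrite bin_gt0.
  apply: leq_trans (dvdn_leq_log _ C0 (divM ds)) _.
  case: ps => [ps|r1]; last by have := logn_bin_le (k := 0) pp Bpr sB; rewrite expn0 dvd1n r1; apply.
  by have := logn_bin_le pp Bpr sB ps; lia.
move: (trunc_log p B) prB Bpr prd r0 => [|[|r]] //= prB Bpr prd _.
  by exists d.+1; [nia|right].
exists (p ^ r.+1); last by left.
have p1 := prime_gt1 pp.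
have pr : p <= p ^ r.+1 by rewrite -{1}(expn1 p) leq_exp2l.
rewrite expnS in prd prB; apply/andP; split.
  rewrite ltnNge; apply/negP => prd'; have := leq_mul (leq_trans pr prd') prd'; lia.
have := leq_mul p1 (leqnn (p ^ r.+1)); nia.
Qed.

End BinomialsDivisible.

Lemma expn_gap X Y g : X < Y -> X ^ g.+2 + 2 * X ^ g.+1 <= Y ^ g.+2.
Proof.
move=> XY; apply: (@leq_trans (X.+1 ^ g.+2)); last by rewrite leq_exp2r.
have : X ^ g <= X.+1 ^ g by case: g => // g; rewrite leq_exp2r.
by rewrite !expnS; move: (X ^ g) (X.+1 ^ g) => a b; nia.
Qed.

(** If g > 1 divides both exponents, the two powers are g-th powers in an
    interval [B - d, B]; consecutive g-th powers X^g and (X + 1)^g are at least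
    2 X^(g-1) apart, which exceeds d because X^(2g-2) >= X^g > d^2. *)
Lemma near_powers_coprime d B p q r s : prime p -> prime q -> p != q ->
  0 < r -> 0 < s -> d * d + 2 * d < B ->
  B - d <= p ^ r <= B -> B - d <= q ^ s <= B -> coprime r s.
Proof.
move=> pp pq npq r0 s0 dB hp hq; rewrite /coprime.
case Eg : (gcdn r s) => [|[|g]] //.
  by move: (dvdn_gcdl r s); rewrite Eg dvd0n; lia.
have [k er] : exists k, r = k * g.+2 by apply/dvdnP; rewrite -Eg dvdn_gcdl.
have [l es] : exists l, s = l * g.+2 by apply/dvdnP; rewrite -Eg dvdn_gcdr.
have key X Y : 0 < X -> B - d <= X ^ g.+2 <= B -> B - d <= Y ^ g.+2 <= B -> X < Y -> False.
  move=> X0 hX hY /(expn_gap g); move: hX hY; rewrite !(expnS _ g.+1) (expnS X g) => hX hY h.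
  have Xg : 0 < X ^ g by rewrite expn_gt0 X0.
  have X2 : X * (X * X ^ g) <= (X * X ^ g) * (X * X ^ g) by nia.
  have : 2 * (X * X ^ g) <= d by lia.
  move: (X * X ^ g) X2 hX => a X2 hX ad; have := leq_mul ad ad; nia.
have p0 := prime_gt0 pp; have q0 := prime_gt0 pq.
rewrite er expnM in hp; rewrite es expnM in hq.
case: (ltngtP (p ^ k) (q ^ l)).
- by move=> /(key _ _ _ hp hq); rewrite expn_gt0 p0 => /(_ isT).
- by move=> /(key _ _ _ hq hp); rewrite expn_gt0 q0 => /(_ isT).
move=> e; case/negP: npq; rewrite -dvdn_prime2 //.
have : p %| q ^ l by rewrite -e dvdn_exp //; case: (k) er r0 => //; lia.
by rewrite Euclid_dvdX // => /andP[].
Qed.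

(** * The exponents of the prime divisors of A *)

(** This lemma and the next one bound a product of primes without logarithms: if
    p^r <= B, then p^m <= B^(m/r) for any common multiple m of the exponents r. *)
Lemma prod_expn_le (ps : seq nat) (f : nat -> nat) m B :
  (forall p, p \in ps -> p ^ m <= B ^ f p) ->
  (\prod_(p <- ps) p) ^ m <= B ^ (\sum_(p <- ps) f p).
Proof.
elim: ps => [_|p ps IH h]; first by rewrite !big_nil exp1n.
rewrite !big_cons expnMn expnD leq_mul ?h ?mem_head // IH // => q qps.
by apply: h; rewrite inE qps orbT.
Qed.

Lemma prod_expn_lt (ps : seq nat) (f : nat -> nat) m A : ps != [::] ->
  (forall p, p \in ps -> A ^ f p < p ^ m) ->
  A ^ (\sum_(p <- ps) f p) < (\prod_(p <- ps) p) ^ m.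
Proof.
elim: ps => // p [|q ps] IH _ h; first by rewrite !big_seq1 h ?mem_head.
rewrite !(big_cons _ _ p) expnMn expnD ltn_mul ?h ?mem_head // IH // => r rps.
by apply: h; rewrite inE rps orbT.
Qed.

Lemma prod_primes_squarefree M : 0 < M -> (forall p, prime p -> p %| M -> logn p M <= 1) ->
  \prod_(p <- primes M) p = M.
Proof.
move=> M0 h; rewrite [RHS]prod_prime_decomp // prime_decompE big_map /=.
apply: eq_big_seq => p; rewrite mem_primes => /and3P[pp _ pM].
by have -> : logn p M = 1; [apply/eqP; rewrite eqn_leq h //= logn_gt0 mem_primes pp M0|rewrite expn1].
Qed.

(** Bernoulli's inequality for (1 - 1/(d+1))^h. *)
Lemma bernoulli d h : h <= d -> d.+1 ^ h * (d.+1 - h) <= d.+1 * d ^ h.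
Proof.
elim: h => [_|h IH hd]; first by rewrite !expn0; lia.
have [k dE] : exists k, d = k + h.+1 by exists (d - h.+1); lia.
have := IH (ltnW hd); rewrite !expnS.
have -> : d.+1 - h = k.+2 by lia.
have -> : d.+1 - h.+1 = k.+1 by lia.
move: (d.+1 ^ h) (d ^ h) => a b ab.
have := leq_mul (leqnn d) ab; have : d.+1 * k.+1 <= d * k.+2 by lia.
move=> /(leq_mul (leqnn a)); lia.
Qed.

(** (1 + 1/d)^d <= 4: split the exponent d into two halves, to each of which
    Bernoulli's inequality applies with a loss of about one half. *)
Lemma succ_expn_le d : d.+1 ^ d <= 4 * d ^ d.
Proof.
have [h [k [dE hk]]] : exists h k, d = h + k /\ h <= k <= h.+1.
  by exists d./2, (uphalf d); have := odd_double_half d; rewrite uphalf_half; lia.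
have := bernoulli (d := d) (h := h); have := bernoulli (d := d) (h := k).
have -> : d.+1 - k = h.+1 by lia.
have -> : d.+1 - h = k.+1 by lia.
move=> /(_ ltac:(lia)) hk1 /(_ ltac:(lia)) hh1.
have -> : d.+1 ^ d = d.+1 ^ h * d.+1 ^ k by rewrite -expnD -dE.
have -> : d ^ d = d ^ h * d ^ k by rewrite -expnD -dE.
have hk4 : d.+1 * d.+1 <= 4 * (h.+1 * k.+1).
  have [] : k = h \/ k = h.+1 by lia.
    by move=> kh; rewrite dE kh; lia.
  by move=> kh; rewrite dE kh; lia.
rewrite -(leq_pmul2r (_ : 0 < h.+1 * k.+1)) //.
have := leq_mul hh1 hk1; have := leq_mul hk4 (leqnn (d ^ h * d ^ k)).
lia.
Qed.

Section ParameterConstraints.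
Variables d e : nat.
Hypotheses (d_gt0 : 0 < d) (de : d <= e).
Local Notation A := (d * e + 1).
Local Notation B := (d.+1 * e.+1 + 1).
Local Notation ex p := (trunc_log p B).
Hypothesis divA : forall s, d < s < B - d -> A %| 'C(B, s).

Lemma short_interval : d * d + 2 * d < B.
Proof. nia. Qed.

Lemma A_prime_le p : p %| A -> p <= B.
Proof. by move/dvdn_leq => h; apply: leq_trans (h _) _; lia. Qed.

(** The exponent is not 1 because p <= A < B - d. *)
Lemma A_power p : prime p -> p %| A -> [/\ 1 < ex p, A < p ^ ex p & B - d <= p ^ ex p <= B].
Proof.
move=> pp pA; have pB := A_prime_le pA.
have Bpr := prime_power_near d_gt0 short_interval divA pp pB pA.
have /andP[prB _] := trunc_log_prime_bounds pp (leq_ltn_trans (leq0n _) short_interval).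
rewrite Bpr prB; split=> //; last by lia.
rewrite ltn_neqAle eq_sym (exponent_gt0 pp pB) andbT; apply/eqP => e1.
by rewrite e1 expn1 in Bpr; have := dvdn_leq _ pA; lia.
Qed.

Lemma A_coprime p q : prime p -> prime q -> p %| A -> q %| A -> p != q ->
  coprime (ex p) (ex q).
Proof.
move=> pp pq pA qA npq; have [p1 _ hp] := A_power pp pA; have [q1 _ hq] := A_power pq qA.
by apply: (near_powers_coprime pp pq npq _ _ short_interval hp hq); apply: ltnW.
Qed.

Lemma A_prod_primes : \prod_(p <- primes A) p = A.
Proof.
apply: prod_primes_squarefree => [|p pp pA]; first by lia.
exact: (logn_le1 d_gt0 short_interval divA pp (A_prime_le pA) pA).
Qed.

(** Let c = p^r - (A + e), so that 1 <= c <= d + 1.  Then p divides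
    d p^r - (d + 1) A = d c - 1, which is positive as d > 1. *)
Lemma A_prime_bound p : 1 < d -> prime p -> p %| A -> p < d * d + d.
Proof.
move=> d1 pp pA; have [r1 Apr /andP[Bpr prB]] := A_power pp pA.
have [c ec] : exists c, p ^ ex p = A + e + c by exists (p ^ ex p - (A + e)); lia.
have c0 : 0 < c <= d.+1 by lia.
have : p %| d * p ^ ex p - d.+1 * A.
  by rewrite dvdn_sub ?dvdn_mull // dvdn_exp //; lia.
have -> : d * p ^ ex p - d.+1 * A = d * c - 1 by rewrite ec; nia.
by move/dvdn_leq; nia.
Qed.

(** For d = 1 one has B = 2 A + 1, so p^r is 2 A or 2 A + 1; as p divides A, it is
    2 A, whence p = 2.  Being squarefree, A equals 2. *)
Lemma d_eq1_e_eq1 : d = 1 -> e = 1.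
Proof.
move=> d1; have p2 p : prime p -> p %| A -> p = 2.
  move=> pp pA; have [r1 _ h] := A_power pp pA.
  have ppr : p %| p ^ ex p by rewrite dvdn_exp //; lia.
  have [e2A|e2A1] : p ^ ex p = A * 2 \/ p ^ ex p = A * 2 + 1 by lia.
    have : 2 %| p ^ ex p by rewrite e2A dvdn_mull.
    by rewrite Euclid_dvdX // => /andP[]; rewrite dvdn_prime2 // => /eqP.
  by move: ppr; rewrite e2A1 dvdn_addr ?dvdn_mulr // dvdn1 => /eqP p1; rewrite p1 in pp.
have : primes A = [:: 2] -> A = 2 by move=> e2; rewrite -A_prod_primes e2 big_seq1.
move=> A2; suff /A2 : primes A = [:: 2] by rewrite d1; lia.
have : {subset primes A <= [:: 2]}.
  by move=> p; rewrite mem_primes inE => /and3P[pp _ pA]; rewrite (p2 p).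
have : 2 \in primes A.
  have A1 : 1 < A by nia.
  have := pdiv_prime A1; have := pdiv_dvd A => pA pp.
  by rewrite mem_primes -(p2 _ pp pA) pp pA; lia.
have := primes_uniq A; case: (primes A) => [|p [|q s]] // /andP[pq _] _ h.
  by have := h p (mem_head _ _); rewrite inE => /eqP ->.
have := h p (mem_head _ _); have := h q; rewrite !inE eqxx orbT => /(_ isT)/eqP eq /eqP ep.
by rewrite inE ep eq in pq.
Qed.

Lemma B_over_A : B * d ^ 2 <= A * d.+1 ^ 2.
Proof. rewrite !expnS !expn0; nia. Qed.

(** The sum of the inverses of the exponents is the fraction
    [exponent_sum / exponent_prod]. *)
Definition exponent_prod := \prod_(p <- primes A) ex p.
Definition exponent_sum := \sum_(p <- primes A) exponent_prod %/ ex p.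

Lemma exponent_dvd p : p \in primes A -> ex p %| exponent_prod.
Proof.
move=> pA; rewrite /exponent_prod (big_rem p) //=; exact: dvdn_mulr.
Qed.

Lemma exponent_prod_gt0 : 0 < exponent_prod.
Proof.
rewrite /exponent_prod big_seq; apply: prodn_cond_gt0 => p.
by rewrite mem_primes => /and3P[pp _ /(A_power pp)[r1 _ _]]; apply: ltnW.
Qed.

(** A is the product of its primes p, each larger than A^(1/r). *)
Lemma exponent_sum_lt : exponent_sum < exponent_prod.
Proof.
have A1 : 1 < A by nia.
rewrite -(ltn_exp2l _ _ A1) -{2}A_prod_primes; apply: prod_expn_lt.
  apply/eqP => e0; have := pdiv_prime A1 => pp.
  have : pdiv A \in primes A by rewrite mem_primes pp pdiv_dvd; lia.
  by rewrite e0.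
move=> p pA; have rP := exponent_dvd pA.
move: pA; rewrite mem_primes => /and3P[pp _ pA]; have [r1 Apr _] := A_power pp pA.
rewrite -{2}(divnK rP) [_ %/ _ * _]mulnC expnM ltn_exp2r // divn_gt0 ?(ltnW r1) //.
by apply: dvdn_leq rP; apply: exponent_prod_gt0.
Qed.

Lemma A_exponent_bound : A ^ exponent_prod <= B ^ exponent_sum.
Proof.
rewrite -{1}A_prod_primes; apply: prod_expn_le => p pA; have rP := exponent_dvd pA.
move: pA; rewrite mem_primes => /and3P[pp _ pA]; have [r1 _ /andP[_ prB]] := A_power pp pA.
rewrite -{1}(divnK rP) [_ %/ _ * _]mulnC expnM leq_exp2r // divn_gt0 ?(ltnW r1) //.
by apply: dvdn_leq rP; apply: exponent_prod_gt0.
Qed.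

(** The sum sigma of the inverses satisfies A <= B^sigma, so that
    B^(1 - sigma) <= B / A <= (1 + 1/d)^2; taking d-th powers and bounding
    (1 + 1/d)^d by 4 gives (1 - sigma) d log2 B <= 4. *)
Lemma exponent_defect :
  (exponent_prod - exponent_sum) * trunc_log 2 B * d <= 4 * exponent_prod.
Proof.
move: exponent_sum_lt A_exponent_bound exponent_prod_gt0.
move: exponent_prod exponent_sum => P Q QP APQ P0.
have h1 : B ^ (P - Q) * (d ^ 2) ^ P <= (d.+1 ^ 2) ^ P.
  have AP : 0 < A ^ P by rewrite expn_gt0; lia.
  rewrite -(leq_pmul2r AP) mulnAC; move: B_over_A; move: (d ^ 2) (d.+1 ^ 2) => x y BxAy.
  apply: (@leq_trans (B ^ (P - Q) * B ^ Q * x ^ P)); first by rewrite leq_mul2r leq_mul2l APQ !orbT.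
  rewrite -expnD subnK ?(ltnW QP) // -!expnMn [y * A]mulnC.
  by rewrite leq_exp2r.
have h2 : B ^ ((P - Q) * d) <= 2 ^ (4 * P).
  have dd : 0 < d ^ (d * (2 * P)) by rewrite expn_gt0 d_gt0.
  rewrite -(leq_pmul2r dd).
  have e2 : ((d ^ 2) ^ P) ^ d = d ^ (d * (2 * P)) by rewrite -!expnM; congr (_ ^ _); lia.
  have e3 : ((d.+1 ^ 2) ^ P) ^ d = (d.+1 ^ d) ^ (2 * P) by rewrite -!expnM; congr (_ ^ _); lia.
  apply: (@leq_trans ((4 * d ^ d) ^ (2 * P))); last first.
    have -> : 4 * P = 2 * (2 * P) by lia.
    by rewrite expnMn -expnM (expnM 2 2).
  apply: (@leq_trans ((d.+1 ^ d) ^ (2 * P))); last first.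
    by rewrite leq_exp2r ?succ_expn_le // muln_gt0.
  rewrite -e2 -e3 expnM -expnMn; case: (posnP d) => [|d0]; first by lia.
  by rewrite leq_exp2r.
have h3 : 2 ^ ((P - Q) * trunc_log 2 B * d) <= 2 ^ (4 * P).
  apply: leq_trans h2; rewrite mulnAC mulnC expnM.
  case: ((P - Q) * d) => [|k]; first by rewrite !expn0.
  by rewrite leq_exp2r // trunc_logP //; lia.
by rewrite leq_exp2l in h3.
Qed.

(** B <= p^r + d <= (p + d)^r and p + d <= (d + 1)^2. *)
Lemma exponent_d_bound p : 1 < d -> p \in primes A -> 2 ^ trunc_log 2 B <= d.+1 ^ (2 * ex p).
Proof.
move=> d1; rewrite mem_primes => /and3P[pp _ pA].
have [r1 _ /andP[Bpr _]] := A_power pp pA; have pd := A_prime_bound d1 pp pA.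
apply: leq_trans (trunc_logP (isT : 1 < 2) _) _; first by lia.
apply: (@leq_trans (p ^ ex p + d)); first by lia.
rewrite expnM; apply: (@leq_trans ((p + d) ^ ex p)); last first.
  by rewrite leq_exp2r; rewrite ?expnS ?expn0; lia.
case: (ex p) r1 => // r _; rewrite !expnS mulnDl.
have : p ^ r <= (p + d) ^ r by case: r => // r; rewrite leq_exp2r // leq_addr.
have : 0 < p ^ r by rewrite expn_gt0 prime_gt0.
by nia.
Qed.
End ParameterConstraints.

(** * Search through the sets of exponents *)

Lemma of_nat_expn a b : N.of_nat (a ^ b) = (N.of_nat a ^ N.of_nat b)%N.
Proof.
elim: b => [|b IH] //; rewrite expnS Nat2N.inj_mul IH Nat2N.inj_succ N.pow_succ_r //; lia.
Qed.

Lemma of_natM a b : N.of_nat (a * b) = (N.of_nat a * N.of_nat b)%N.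
Proof. lia. Qed.

Lemma of_natB a b : N.of_nat (a - b) = (N.of_nat a - N.of_nat b)%N.
Proof. lia. Qed.

(** P and Q encode the sum Q / P of the inverses of some exponents, the least of
    them being rm and the largest r.  One more exponent R, larger than r, is to
    be added; L is a lower bound for log2 B.  The inequality of [exponent_defect]
    is weakest, as a bound on d, for the least R > r that keeps the sum of inverses
    below 1: a larger R increases the defect and can only increase the
    lower bound max(L, R) for log2 B.  For this R the bound on d is b, and the test
    asks whether b contradicts d >= 2 or (d + 1)^(2 rm) >= B. *)
Definition dead_beyond (rm P Q L r : N) : bool :=
  (let D := P - Q in
   let R := N.max (r + 1) (P / D + 1) in
   let L' := N.max L R in
   let b := 4 * P * R / ((D * R - P) * L') in
   (b <? 2) || (2 * rm * N.size (b + 1) <=? L'))%N.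

Lemma dead_beyondP (rm P Q L r R L' d : N) : dead_beyond rm P Q L r ->
  (0 < rm -> Q < P -> r < R -> R <= L' -> L <= L' -> 2 <= d ->
   P < (P - Q) * R -> ((P - Q) * R - P) * L' * d <= 4 * P * R ->
   2 ^ L' <= (d + 1) ^ (2 * rm) -> False)%N.
Proof.
rewrite /dead_beyond; set D := (P - Q)%N; set R0 := N.max _ _; set L0 := N.max _ _.
set b := (_ / _)%N => dead rm0 QP rR RL LL d2 PDR defect dL.
have D0 : (0 < D)%N by lia.
have PR : (P / D < R)%N by apply: N.Div0.div_lt_upper_bound; lia.
have R0R : (R0 <= R)%N by lia.
have PDR0 : (P < D * R0)%N.
  have := N.mul_succ_div_gt P D; have : (P / D + 1 <= R0)%N by lia.
  move=> /(N.mul_le_mono_l _ _ D); lia.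
have L0L : (L0 <= L')%N by lia.
have db : (d <= b)%N.
  apply: N.div_le_lower_bound; first by nia.
  (* The bound for R is carried over to R0 <= R after multiplication by R. *)
  have R_gt0 : (0 < R)%N by lia.
  apply/(N.mul_le_mono_pos_l _ _ _ R_gt0).
  have h1 : (R * (D * R0 - P) <= R0 * (D * R - P))%N by nia.
  have h2 := N.mul_le_mono _ _ _ _ h1 L0L.
  have := N.mul_le_mono_r _ _ d h2; have := N.mul_le_mono_l _ _ R0 defect; lia.
case/orP: dead => [/N.ltb_lt|/N.leb_le szb]; first by lia.
have db1 : (d + 1 < 2 ^ N.size (b + 1))%N by have := N.size_gt (b + 1); lia.
have : ((d + 1) ^ (2 * rm) < (2 ^ N.size (b + 1)) ^ (2 * rm))%N by apply: N.pow_lt_mono_l; lia.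
rewrite -N.pow_mul_r => h; have : (2 ^ (N.size (b + 1) * (2 * rm)) <= 2 ^ L')%N.
  by apply: N.pow_le_mono_r; lia.
lia.
Qed.

Lemma dead_beyond_nat rm P Q L r R L' d :
  dead_beyond (N.of_nat rm) (N.of_nat P) (N.of_nat Q) (N.of_nat L) (N.of_nat r) ->
  0 < rm -> Q < P -> r < R -> R <= L' -> L <= L' -> 1 < d ->
  Q * R + P < P * R -> (P * R - (Q * R + P)) * L' * d <= 4 * (P * R) ->
  2 ^ L' <= d.+1 ^ (2 * rm) -> False.
Proof.
move=> dead rm0 QP rR RL LL d1 lt defect dL.
have dRE : ((P - Q) * R - P = P * R - (Q * R + P)) by rewrite mulnBl subnDA.
apply: (dead_beyondP (R := N.of_nat R) (L' := N.of_nat L') (d := N.of_nat d) dead);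
  try (clear -rm0 QP rR RL LL d1; lia).
- have : P < (P - Q) * R by rewrite mulnBl ltn_subRL.
  by rewrite -of_natB -of_natM; move: ((P - Q) * R) => x; clear; lia.
- have -> : (4 * N.of_nat P * N.of_nat R = N.of_nat (4 * (P * R)))%N by clear; lia.
  rewrite -of_natB -of_natM -of_natB -!of_natM.
  by move: defect; rewrite -dRE; move: (_ * d) (4 * _) => x y; clear; lia.
have -> : (N.of_nat d + 1 = N.of_nat d.+1)%N by lia.
rewrite (_ : 2 * N.of_nat rm = N.of_nat (2 * rm))%N; last by lia.
by rewrite -(of_nat_expn 2) -of_nat_expn; move: (2 ^ L') (_ ^ _) dL; clear; lia.
Qed.

(** Depth-first enumeration, in increasing order, of the sets of pairwise coprime
    exponents taken from cs; rm is the least exponent chosen so far, 0 if there is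
    none.  An exponent r other than the largest satisfies m r <= log2 B. *)
Fixpoint search (m L0 : N) (cs : seq N) (rm P Q : N) : bool :=
  if cs is r :: cs' then
    search m L0 cs' rm P Q &&
    (if (N.gcd P r =? 1)%N then
       let P' := (P * r)%N in let Q' := (Q * r + P)%N in
       if (P' <=? Q')%N then true else
       let rm' := if (rm =? 0)%N then r else rm in
       dead_beyond rm' P' Q' (N.max (m * r) L0) r && search m L0 cs' rm' P' Q'
     else true)
  else true.

(** From Q / P to Q / P + 1 / r. *)
Definition frac_step (PQ : nat * nat) r := (PQ.1 * r, PQ.2 * r + PQ.1).

Lemma foldl_frac_step_lt s PQ : (foldl frac_step PQ s).2 < (foldl frac_step PQ s).1 -> PQ.2 < PQ.1.
Proof.
elim: s PQ => [|r s IH] // PQ /IH /=; case: PQ => P Q /=; case: (ltnP Q P) => // PQ.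
by have := leq_mul PQ (leqnn r); lia.
Qed.

Lemma foldl_frac_stepE s : all (ltn 0) s ->
  foldl frac_step (1, 0) s = (\prod_(r <- s) r, \sum_(r <- s) (\prod_(t <- s) t) %/ r).
Proof.
elim/last_ind: s => [|s r IH] /=; first by rewrite !big_nil.
rewrite all_rcons => /andP[r0 s0]; rewrite foldl_rcons IH // /frac_step /=.
have -> : \prod_(t <- rcons s r) t = (\prod_(t <- s) t) * r by rewrite -cats1 big_cat big_seq1.
congr (_, _); rewrite -cats1 big_cat /= big_seq1 mulnK // big_distrl /=; congr (_ + _).
apply: eq_big_seq => t ts; have tP : t %| \prod_(t <- s) t by rewrite (big_rem t) //= dvdn_mulr.
by rewrite -{2}(divnK tP) mulnAC mulnK //; apply: (allP s0).
Qed.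

Lemma coprime_Ngcd a b : coprime a b -> N.gcd (N.of_nat a) (N.of_nat b) = 1%N.
Proof.
move=> ab; set g := N.gcd _ _.
have dv x : N.divide g (N.of_nat x) -> N.to_nat g %| x.
  by case=> z ez; apply/dvdnP; exists (N.to_nat z); lia.
have : N.to_nat g %| gcdn a b.
  by rewrite dvdn_gcd; apply/andP; split; apply: dv; [apply: N.gcd_divide_l|apply: N.gcd_divide_r].
by rewrite (eqP ab) dvdn1 => /eqP; lia.
Qed.

Lemma searchP m L0 (cs T : seq nat) rm P Q :
  search (N.of_nat m) (N.of_nat L0) [seq N.of_nat i | i <- cs] (N.of_nat rm) (N.of_nat P) (N.of_nat Q) ->
  subseq T cs -> T != [::] -> pairwise coprime T -> all (coprime P) T -> all (ltn 0) T ->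
  let PQ := foldl frac_step (P, Q) T in PQ.2 < PQ.1 ->
  let rm' := if rm == 0 then head 0 T else rm in
  dead_beyond (N.of_nat rm') (N.of_nat PQ.1) (N.of_nat PQ.2)
    (N.of_nat (maxn (m * last 0 T) L0)) (N.of_nat (last 0 T)).
Proof.
elim: cs T rm P Q => [|r cs IH] T rm P Q /=; first by move=> _ /eqP ->.
case/andP=> h1 h2; case: T => [|t T] //.
rewrite [subseq _ _]/=; case: eqP => [->|_]; last by move=> sT; apply: IH.
move=> sT _ /= /andP[rT cT] /andP[Pr PT] /andP[r0 T0] QP.
have rmE : (if (N.of_nat rm =? 0)%N then N.of_nat r else N.of_nat rm) =
   N.of_nat (if rm == 0 then r else rm) by case: rm {h1 h2} => [|rm].
move: h2; rewrite (coprime_Ngcd Pr) /= rmE -!Nat2N.inj_mul -Nat2N.inj_add.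
have := foldl_frac_step_lt QP; rewrite /frac_step /= => QP1.
case: N.leb_spec => [|_]; first by lia.
have -> : N.max (N.of_nat (m * r)) (N.of_nat L0) = N.of_nat (maxn (m * r) L0) by lia.
move=> /andP[].
case: T sT rT cT PT T0 QP => [|t' T] sT rT cT PT T0 QP; first by [].
move=> _ h2; have := IH (t' :: T) _ _ _ h2 sT isT cT.
have -> : all (coprime (P * r)) (t' :: T).
  by apply/allP => x xT; rewrite coprimeMl (allP PT) // (allP rT).
move=> /(_ isT T0 QP) /=; case: (rm) => [|rm'] //=.
by case: (r) r0.
Qed.

(** * Gaps between prime powers *)

Fixpoint powers (fuel : nat) (lo hi p x : N) : seq N :=
  if fuel is f.+1 then
    if (hi <=? x)%N then [::] else
    let l := powers f lo hi p (x * p)%N in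
    if (lo <=? x)%N then x :: l else l
  else [::].

Lemma mem_powers f (lo hi : N) p x k : 0 < p -> k < f ->
  (lo <= N.of_nat (x * p ^ k))%N -> (N.of_nat (x * p ^ k) < hi)%N ->
  N.of_nat (x * p ^ k) \in powers f lo hi (N.of_nat p) (N.of_nat x).
Proof.
move=> p0; elim: f x k => // f IH x k kf lox xhi /=.
have xp : x * 1 <= x * p ^ k by rewrite leq_mul2l expn_gt0 p0 orbT.
case: N.leb_spec => [|_]; first by lia.
case: k kf lox xhi xp => [|k] kf lox xhi xp.
  by rewrite muln1 in lox *; case: N.leb_spec => [_|]; [rewrite mem_head|lia].
rewrite -Nat2N.inj_mul; rewrite expnS mulnA in lox xhi *.
have h := IH (x * p) k kf lox xhi.
by case: N.leb => //; rewrite inE h orbT.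
Qed.

(** A computable sufficient condition for (b - a) (b - a + 1) >= b that needs only
    the numbers of binary digits. *)
Definition far (a b : N) := ((a <? b) && (N.size b + 2 <=? 2 * N.size (b - a)))%N.

Lemma far_gap a b : far a b -> ((a <? b) && (b <=? (b - a) * (b - a) + (b - a)))%N.
Proof.
case/andP=> /N.ltb_lt ab /N.leb_le sz; apply/andP; split; first exact/N.ltb_lt.
apply/N.leb_le; set c := (b - a)%N in sz *.
have hb := N.size_gt b; have hc := N.size_le c.
have h : (2 ^ (N.size b + 2) <= 2 ^ (2 * N.size c))%N by apply: N.pow_le_mono_r; lia.
rewrite N.pow_add_r N.mul_comm (N.mul_comm 2 (N.size c)) N.pow_mul_r in h.
rewrite (N.pow_2_r (2 ^ _)) N.succ_double_spec in h hc; have := N.mul_le_mono _ _ _ _ hc hc.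
by move: h hb; rewrite (_ : 2 ^ 2 = 4)%N //; lia.
Qed.

Definition prime_powers m lo hi : seq N :=
  flatten [seq powers hi (2 ^ N.of_nat lo) (2 ^ N.of_nat hi) (N.of_nat p) (N.of_nat p)
          | p <- iota 2 (2 ^ m) & prime p].

Lemma mem_prime_powers m lo hi p r : prime p -> p < 2 ^ m -> 0 < r ->
  2 ^ lo <= p ^ r < 2 ^ hi -> N.of_nat (p ^ r) \in prime_powers m lo hi.
Proof.
move=> pp pm; case: r => // r _ /andP[lor rhi].
apply/flatten_mapP; exists p.
  by rewrite mem_filter pp mem_iota prime_gt1 //= (leq_trans pm) // leq_addl.
rewrite expnS; apply: mem_powers; rewrite -?expnS; first exact: prime_gt0.
- rewrite -(ltn_exp2l _ _ (isT : 1 < 2)); apply: leq_ltn_trans rhi.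
  apply: (@leq_trans (2 ^ r.+1)); first by rewrite leq_exp2l.
  by rewrite leq_exp2r // prime_gt1.
- by rewrite -(of_nat_expn 2 lo); lia.
- by rewrite -(of_nat_expn 2 hi); lia.
Qed.

(** Adjacent elements are enough: the relation of [far_gap] is transitive. *)
Definition powers_far m lo hi := sorted far (sort N.leb (prime_powers m lo hi)).

Lemma powers_farP m lo hi p q r s : powers_far m lo hi ->
  prime p -> prime q -> p < 2 ^ m -> q < 2 ^ m -> 0 < r -> 0 < s ->
  2 ^ lo <= p ^ r < 2 ^ hi -> 2 ^ lo <= q ^ s < 2 ^ hi -> p ^ r < q ^ s ->
  q ^ s <= (q ^ s - p ^ r) * (q ^ s - p ^ r) + (q ^ s - p ^ r).
Proof.
move=> srt pp pq pm qm r0 s0 hp hq pqlt.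
have hx := mem_prime_powers pp pm r0 hp; have hy := mem_prime_powers pq qm s0 hq.
have : pairwise (fun a b => (a <? b) && (b <=? (b - a) * (b - a) + (b - a)))%N
   (sort N.leb (prime_powers m lo hi)).
  rewrite -sorted_pairwise; first by apply: sub_sorted srt => a b /far_gap.
  move=> b a c /andP[/N.ltb_lt ab _] /andP[/N.ltb_lt bc /N.leb_le h] /=.
  apply/andP; split; [apply/N.ltb_lt; lia|apply/N.leb_le].
  have : (c - b <= c - a)%N by lia.
  by nia.
rewrite -(mem_sort N.leb) in hx; rewrite -(mem_sort N.leb) in hy.
move: (sort _ _) hx hy => l; elim: l => // z l IH; rewrite !inE /= => hx hy /andP[zl pl].
case/orP: hx hy => [/eqP ez|hx] /orP[/eqP ez'|hy].
- by lia.
- have := allP zl _ hy; rewrite -ez => /andP[_ /N.leb_le]; lia.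
- by have := allP zl _ hx; rewrite -ez' => /andP[/N.ltb_lt]; lia.
by apply: IH.
Qed.

(** * The case B < 2^14 *)

(** Bases below 128 suffice since the exponents are at least 2. *)
Definition small_powers : seq (N * N) :=
  flatten [seq [seq (N.of_nat p, x) | x <- powers 14 0 (2 ^ 14) (N.of_nat p) (N.of_nat (p * p))]
          | p <- iota 2 126 & prime p].

(** The position of p^r in [B - d, B] determines e from d: as
    B - d = (d + 1) e + 2, e is the quotient of p^r - 2 by d + 1. *)
Definition excluded (px qy : N * N) (d : N) : bool :=
  (let e := (px.2 - 2) / (d + 1) in let A := d * e + 1 in
   [|| e <? d, (d + 1) * (e + 1) + 1 <? qy.2, negb (A mod px.1 =? 0) | negb (A mod qy.1 =? 0)])%N.

Definition pair_excluded (px qy : N * N) : bool :=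
  if (px.2 <? qy.2)%N && (qy.2 - px.2 <? 128)%N
  then all (excluded px qy) [seq N.of_nat d | d <- iota 2 126] else true.

Lemma all_pairs_excluded : allrel pair_excluded small_powers small_powers.
Proof. vm_compute; reflexivity. Qed.

Lemma mem_small_powers p r : prime p -> 1 < r -> p ^ r < 2 ^ 14 ->
  (N.of_nat p, N.of_nat (p ^ r)) \in small_powers.
Proof.
move=> pp; case: r => [|[|r]] // _ pr14.
have p128 : p < 128.
  rewrite -(ltn_exp2r _ _ (isT : 0 < 2)); apply: leq_ltn_trans pr14.
  by rewrite leq_exp2l // prime_gt1.
apply/flatten_mapP; exists p.
  by rewrite mem_filter pp mem_iota prime_gt1.
apply/mapP; exists (N.of_nat (p ^ r.+2)) => //.
have e : p ^ r.+2 = p * p * p ^ r by rewrite !expnS mulnA.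
rewrite e; apply: mem_powers; rewrite -?e; first exact: prime_gt0.
- have h : 2 ^ r.+2 < 2 ^ 14.
    by apply: leq_ltn_trans pr14; rewrite leq_exp2r // prime_gt1.
  by rewrite ltn_exp2l // in h; lia.
- lia.
by rewrite -(of_nat_expn 2 14); lia.
Qed.

Lemma no_small_parameters d e p q r s (B := d.+1 * e.+1 + 1) :
  1 < d -> d <= e -> B < 2 ^ 14 -> prime p -> prime q -> 1 < r -> 1 < s ->
  B - d <= p ^ r -> p ^ r < q ^ s -> q ^ s <= B ->
  p %| d * e + 1 -> q %| d * e + 1 -> False.
Proof.
move=> d1 de B14 pp pq r1 s1 Bpr pq_lt qsB pA qA.
have hp := mem_small_powers pp r1 (leq_ltn_trans (ltnW (leq_trans pq_lt qsB)) B14).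
have hq := mem_small_powers pq s1 (leq_ltn_trans qsB B14).
have d128 : d < 128.
  rewrite -(ltn_exp2r _ _ (isT : 0 < 2)); apply: leq_ltn_trans B14.
  by rewrite /B !expnS expn0; nia.
have := all_pairs_excluded; move: small_powers hp hq => l hp hq /allrelP/(_ _ _ hp hq).
rewrite /pair_excluded; case: ifP => [_|/negP []]; last first.
  by apply/andP; split; apply/N.ltb_lt => /=; lia.
move/allP => hd; have := hd (N.of_nat d); rewrite mem_map; last by move=> ? ?; lia.
rewrite mem_iota => /(_ ltac:(lia)); rewrite /excluded /=.
have -> : ((N.of_nat (p ^ r) - 2) / (N.of_nat d + 1) = N.of_nat e)%N.
  have [k kd prE] : exists2 k, k <= d & p ^ r = d.+1 * e + k + 2.
    move: Bpr (leq_trans (ltnW pq_lt) qsB); rewrite /B; move: (p ^ r) => x; clear.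
    by move=> *; exists (x - 2 - d.+1 * e); lia.
  by symmetry; apply: (N.div_unique _ _ _ (N.of_nat k)); rewrite ?prE; clear -kd; lia.
have Amod a : a %| d * e + 1 -> prime a -> ((N.of_nat d * N.of_nat e + 1) mod N.of_nat a =? 0)%N.
  move=> /dvdnP[k ek] pa; apply/N.eqb_eq.
  by rewrite (_ : _ + 1 = N.of_nat k * N.of_nat a)%N ?N.Div0.mod_mul //; clear -ek; lia.
rewrite !Amod // !orbF; case: N.ltb_spec; first by lia.
by case: N.ltb_spec => //; rewrite /B in qsB; lia.
Qed.

(** * Elimination of all parameters with d > 1 *)

Definition exponent_search m L0 L1 :=
  search (N.of_nat m) (N.of_nat L0) [seq N.of_nat i | i <- iota 2 (L1.-1 %/ m).-1] 0 1 0.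

Lemma exponent_search_14_27 : exponent_search 6 14 27.
Proof. vm_compute; reflexivity. Qed.
Lemma exponent_search_27_250 : exponent_search 10 27 250.
Proof. vm_compute; reflexivity. Qed.
Lemma powers_far_13_27 : powers_far 6 13 27.
Proof. vm_compute; reflexivity. Qed.
Lemma powers_far_26_250 : powers_far 10 26 250.
Proof. vm_compute; reflexivity. Qed.

Section Contradiction.
Variables d e : nat.
Hypotheses (d_gt1 : 1 < d) (de : d <= e).
Local Notation A := (d * e + 1).
Local Notation B := (d.+1 * e.+1 + 1).
Local Notation ex p := (trunc_log p B).
Local Notation L := (trunc_log 2 B).
Hypothesis divA : forall s, d < s < B - d -> A %| 'C(B, s).

Let d_gt0 : 0 < d := ltnW d_gt1.

Definition exponents := sort leq [seq ex p | p <- primes A].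

Lemma mem_exponents r : reflect (exists2 p, prime p /\ p %| A & r = ex p) (r \in exponents).
Proof.
rewrite mem_sort; apply: (iffP mapP) => [[p]|[p [pp pA] ->]].
  by rewrite mem_primes => /and3P[pp _ pA] ->; exists p.
by exists p => //; rewrite mem_primes pp pA andbT; lia.
Qed.

Lemma exponent_le_log2 p r : 1 < p -> p ^ r <= B -> r <= L.
Proof.
move=> p1 prB; apply: trunc_log_max => //; apply: leq_trans prB.
by case: r => // r; rewrite leq_exp2r.
Qed.

Lemma exponents_gt1 r : r \in exponents -> 1 < r <= L.
Proof.
case/mem_exponents => p [pp pA] ->; have [-> _ /andP[_ prB]] := A_power d_gt0 de divA pp pA.
exact: exponent_le_log2 (prime_gt1 pp) prB.
Qed.

Lemma exponents_uniq : uniq exponents.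
Proof.
rewrite sort_uniq map_inj_in_uniq ?primes_uniq // => p q; rewrite !mem_primes.
move=> /and3P[pp _ pA] /and3P[pq _ qA] epq; apply/eqP; apply: contraTT (isT) => npq.
have := A_coprime d_gt0 de divA pp pq pA qA npq; rewrite epq /coprime gcdnn.
by case: (A_power d_gt0 de divA pq qA) => q1 _ _; lia.
Qed.

Lemma exponents_sorted : sorted ltn exponents.
Proof. by rewrite ltn_sorted_uniq_leq exponents_uniq sort_sorted //; apply: leq_total. Qed.

Lemma exponents_coprime : pairwise coprime exponents.
Proof.
have : {in exponents &, forall r s, r != s -> coprime r s}.
  move=> r s /mem_exponents[p [pp pA] ->] /mem_exponents[q [pq qA] ->] nrs.
  by apply: (A_coprime d_gt0 de divA) => //; apply: contraNneq nrs => ->.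
move: exponents exponents_uniq; elim=> //= r s IH /andP[rs us] h; apply/andP; split.
  apply/allP => x xs; apply: h; rewrite ?inE ?eqxx ?xs ?orbT //.
  by apply: contraNneq rs => ->.
by apply: IH => // x y xs ys; apply: h; rewrite inE ?xs ?ys orbT.
Qed.

(** If A were a prime p, then p^2 <= B <= 9/4 A = 9/4 p, but A >= 5. *)
Lemma primes_A_size : 1 < size (primes A).
Proof.
have A1 : 4 < A by nia.
have := A_prod_primes d_gt0 de divA; have := primes_uniq A.
have hp p : p \in primes A -> prime p /\ p %| A by rewrite mem_primes => /and3P[].
move: (primes A) hp => [|p [|q ps]] // hp _; first by rewrite big_nil; lia.
rewrite big_seq1 => pA; have [pp _] := hp p (mem_head _ _).
have pdA : p %| A by rewrite pA.
have [r1 _ /andP[_ prB]] := A_power d_gt0 de divA pp pdA.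
have : p ^ 2 <= B by apply: leq_trans prB; rewrite leq_exp2l // prime_gt1.
have := B_over_A d_gt0 de; rewrite -pA; move: A1; rewrite -pA.
move: B p d_gt1 {pA pp pdA r1 prB hp} => b p; rewrite !expnS !expn0 !muln1; clear; nia.
Qed.

Lemma exponents_split : exists T R, [/\ exponents = rcons T R & T != [::]].
Proof.
have : 1 < size exponents by rewrite size_sort size_map primes_A_size.
case/lastP: exponents => // T R; rewrite size_rcons ltnS => T0.
by exists T, R; split=> //; case: T T0.
Qed.

Lemma exponents_fold :
  foldl frac_step (1, 0) exponents = (exponent_prod d e, exponent_sum d e).
Proof.
rewrite foldl_frac_stepE; last by apply/allP => r /exponents_gt1/andP[/ltnW].
have pe : perm_eq exponents [seq ex p | p <- primes A] by rewrite perm_sort.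
have -> : \prod_(r <- exponents) r = exponent_prod d e by rewrite (perm_big _ pe) big_map.
by rewrite (perm_big _ pe) big_map.
Qed.

(** An exponent above log2 B / m belongs to a prime below 2^m.  Two powers of such
    primes would be at distance c <= d, hence c^2 + c <= d^2 + d < B - d, which
    the gap check excludes. *)
Lemma two_small_exponents m lo hi r s : powers_far m lo hi -> 2 ^ lo.+1 <= B < 2 ^ hi ->
  r \in exponents -> s \in exponents -> r < s -> L < m * r -> False.
Proof.
move=> far /andP[Blo Bhi] /mem_exponents[p [pp pA] er] /mem_exponents[q [pq qA] es] rs Lr.
have [r1 _ /andP[Bpr prB]] := A_power d_gt0 de divA pp pA.
have [s1 _ /andP[Bqs qsB]] := A_power d_gt0 de divA pq qA.
rewrite -er in r1 Bpr prB; rewrite -es in s1 Bqs qsB.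
have small x k : prime x -> x ^ k <= B -> L < m * k -> x < 2 ^ m.
  move=> px xk Lk; rewrite ltnNge; apply/negP => mx.
  have k0 : 0 < k by case: (k) Lk => //; rewrite muln0.
  suff : m * k <= L by lia.
  by apply: trunc_log_max => //; rewrite expnM; apply: leq_trans xk; rewrite leq_exp2r.
have pm := small p r pp prB Lr.
have qm : q < 2 ^ m by apply: small pq qsB _; apply: leq_trans Lr _; rewrite leq_mul2l ltnW ?orbT.
have dB := short_interval d_gt0 de.
have lo_Bd : 2 ^ lo <= B - d by move: Blo; rewrite expnS; lia.
have hp : 2 ^ lo <= p ^ r < 2 ^ hi by rewrite (leq_trans lo_Bd) // (leq_ltn_trans prB).
have hq : 2 ^ lo <= q ^ s < 2 ^ hi by rewrite (leq_trans lo_Bd) // (leq_ltn_trans qsB).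
have key x y : B - d <= x -> y <= B -> x < y -> y <= (y - x) * (y - x) + (y - x) -> False.
  move: B dB => b dB Bx yB xy; have yx : y - x <= d by lia.
  have := leq_mul yx yx; lia.
case: (ltngtP (p ^ r) (q ^ s)) => [lt|gt|eq].
- by apply: (key _ _ Bpr qsB lt); apply: (powers_farP far) => //; lia.
- by apply: (key _ _ Bqs prB gt); apply: (powers_farP far) => //; lia.
have : p %| q ^ s by rewrite -eq dvdn_exp //; lia.
rewrite Euclid_dvdX // => /andP[]; rewrite dvdn_prime2 // => /eqP epq _.
by move: rs; rewrite er es epq ltnn.
Qed.

(** All exponents but the largest one, R, are at most log2 B / m by
    [two_small_exponents], so the search has met the set of the others. *)
Lemma no_parameters_in_range m lo L1 (L0 := lo.+1) : powers_far m lo L1 -> exponent_search m L0 L1 ->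
  0 < m -> L0 <= L < L1 -> False.
Proof.
move=> far srch m0 /andP[L0L LL1].
have B0 : 0 < B by lia.
have Bint : 2 ^ lo.+1 <= B < 2 ^ L1.
  apply/andP; split.
    by apply: leq_trans (trunc_logP (isT : 1 < 2) B0); rewrite leq_exp2l.
  by apply: leq_trans (trunc_log_ltn B (isT : 1 < 2)) _; rewrite leq_exp2l.
have [T [R [eTR T0]]] := exponents_split.
have := exponents_sorted; have := exponents_coprime; have := exponents_fold.
rewrite eTR pairwise_rcons => foldE /andP[_ copT].
have gt1 r : r \in rcons T R -> 1 < r <= L by rewrite -eTR; apply: exponents_gt1.
rewrite sorted_pairwise; last exact: ltn_trans.
rewrite pairwise_rcons => /andP[TR]; rewrite -sorted_pairwise; last exact: ltn_trans.
move=> srtT.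
have lastT : last 0 T \in T by case: T T0 {eTR foldE copT gt1 TR srtT} => // t T _; apply: mem_last.
have Tm t : t \in T -> m * t <= L.
  move=> tT; rewrite leqNgt; apply/negP => Lt.
  apply: (two_small_exponents far Bint _ _ (allP TR _ tT) Lt);
    by rewrite eTR mem_rcons inE ?eqxx ?tT ?orbT.
have subT : subseq T (iota 2 (L1.-1 %/ m).-1).
  suff -> : T = [seq i <- iota 2 (L1.-1 %/ m).-1 | i \in T] by apply: filter_subseq.
  apply: (irr_sorted_eq ltn_trans ltnn srtT).
    by apply: sorted_filter (iota_ltn_sorted _ _); apply: ltn_trans.
  move=> t; rewrite mem_filter; case tT : (t \in T) => //=.
  have /andP[t1 _] : 1 < t <= L by apply: gt1; rewrite mem_rcons inE tT orbT.
  have tL1 : t <= L1.-1 %/ m.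
    rewrite leq_divRL // mulnC; apply: leq_trans (Tm t tT) _.
    by rewrite -ltnS (ltn_predK LL1).
  by rewrite mem_iota t1 add2n -(ltn_predK t1) !ltnS; case: (_ %/ _) tL1 t1 => [|k]; case: (t).
move: foldE; rewrite foldl_rcons; case eT : (foldl frac_step (1, 0) T) => [P Q].
rewrite /frac_step /= => -[eP eQ].
have defect := exponent_defect d_gt0 de divA; have lt := exponent_sum_lt d_gt0 de divA.
rewrite -eP -eQ in defect lt.
have QP : Q < P by have := foldl_frac_step_lt (s := [:: R]) (PQ := (P, Q)); apply.
have dead := @searchP m L0 _ T 0 1 0 srch subT T0 copT.
have all1 : all (coprime 1) T by apply/allP => t _; apply: coprime1n.
have all0 : all (ltn 0) T.
  apply/allP => t tT; have /andP[t1 _] : 1 < t <= L by apply: gt1; rewrite mem_rcons inE tT orbT.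
  exact: ltnW.
have := dead all1 all0; rewrite eT => /(_ QP) /= {}dead.
have headT : head 0 T \in T by case: (T) T0 => // t T' _; apply: mem_head.
have R_gt : last 0 T < R by apply: (allP TR).
have /andP[_ RL] : 1 < R <= L by apply: gt1; rewrite mem_rcons mem_head.
have /andP[head1 _] : 1 < head 0 T <= L by apply: gt1; rewrite mem_rcons inE headT orbT.
have dbound : 2 ^ L <= d.+1 ^ (2 * head 0 T).
  have /mem_exponents[p [pp pA] ->] : head 0 T \in exponents.
    by rewrite eTR mem_rcons inE headT orbT.
  by apply: (exponent_d_bound d_gt0 de divA d_gt1); rewrite mem_primes pp pA addn1.
have Lmax : maxn (m * last 0 T) L0 <= L by rewrite geq_max Tm.
exact: (dead_beyond_nat dead (ltnW head1) QP R_gt RL Lmax d_gt1 lt defect dbound).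
Qed.

End Contradiction.

(** The bound is written 2^K with an abstract K so that conversion never
    evaluates 2^250 in unary notation. *)
Lemma no_parameters_d_gt1 d e (A := d * e + 1) (B := d.+1 * e.+1 + 1) K : K = 250 ->
  1 < d -> d <= e -> B < 2 ^ K -> (forall s, d < s < B - d -> A %| 'C(B, s)) -> False.
Proof.
move=> EK d1 de BK divA; have B0 : 0 < B by rewrite /B addn1.
have LK : trunc_log 2 B < K.
  by rewrite -(ltn_exp2l _ _ (isT : 1 < 2)); apply: leq_ltn_trans BK; apply: trunc_logP.
have [L14|L14] := ltnP (trunc_log 2 B) 14; last first.
  have [L27|L27] := ltnP (trunc_log 2 B) 27.
    apply: (@no_parameters_in_range d e d1 de divA 6 13 27 powers_far_13_27 exponent_search_14_27 isT).
    by rewrite L14.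
  apply: (@no_parameters_in_range d e d1 de divA 10 26 250 powers_far_26_250 exponent_search_27_250 isT).
  by rewrite -EK L27.
have B14 : B < 2 ^ 14.
  by apply: leq_trans (trunc_log_ltn B (isT : 1 < 2)) _; rewrite leq_exp2l.
have := primes_A_size d1 de divA; have := primes_uniq A.
have mem p : p \in primes A -> prime p /\ p %| A by rewrite mem_primes => /and3P[].
move: (primes A) mem => [|p [|q ps]] // mem /= /andP[npq _] _.
have [pp pA] := mem p (mem_head _ _).
have [pq qA] : prime q /\ q %| A by apply: mem; rewrite !inE eqxx orbT.
have [r1 _ /andP[Bpr prB]] := A_power (ltnW d1) de divA pp pA.
have [s1 _ /andP[Bqs qsB]] := A_power (ltnW d1) de divA pq qA.
case: (ltngtP (p ^ trunc_log p B) (q ^ trunc_log q B)) => [lt|gt|eq].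
- exact: (no_small_parameters d1 de B14 pp pq r1 s1 Bpr lt qsB pA qA).
- exact: (no_small_parameters d1 de B14 pq pp s1 r1 Bqs gt prB qA pA).
have : p %| q ^ trunc_log q B by rewrite -eq dvdn_exp // ltnW.
by rewrite Euclid_dvdX // => /andP[]; rewrite dvdn_prime2 // => /eqP epq; rewrite epq inE eqxx in npq.
Qed.

Lemma parameters_eq1 d e (A := d * e + 1) (B := d.+1 * e.+1 + 1) K : K = 250 ->
  0 < d -> d <= e -> B < 2 ^ K -> (forall s, d < s < B - d -> A %| 'C(B, s)) ->
  d = 1 /\ e = 1.
Proof.
move=> EK d0 de BK divA; have [d1|d1] := leqP d 1; last first.
  by case: (no_parameters_d_gt1 EK d1 de BK divA).
have d_1 : d = 1 by lia.
by split=> //; apply: (d_eq1_e_eq1 d0 de divA d_1).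
Qed.

Theorem theorem8 (n w : nat) (hn : n < 2 ^ 250) (hw : w <= n) :
  ~ exists C : {set {set 'I_n}}, perfect1_code w C /\ ~ trivial_code w C.
Proof.
case=> C [perfC]; apply; case: (perfect_code_parameters hw perfC) => [C1|]; first by left.
case=> d [e [d0 e0 wE nE [divA lambda]]]; right.
(* An opaque name for 250: see [no_parameters_d_gt1]. *)
have [K EK] : exists K, K = 250 by exists 250.
rewrite -EK in hn.
have BK : d.+1 * e.+1 + 1 < 2 ^ K by apply: leq_ltn_trans hn; rewrite nE wE; clear; lia.
have [d1 e1] : d = 1 /\ e = 1.
  have [de|/ltnW ed] := leqP d e.
    apply: (parameters_eq1 EK d0 de BK) => s /andP[ds sB].
    have [sw|ws] := leqP s w; first by rewrite divA // ds.
    rewrite -bin_sub; last by lia.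
    by apply: divA; rewrite wE in ws *; nia.
  have [] : e = 1 /\ d = 1; last by [].
  (* The roles of d and e are exchanged by taking complements. *)
  apply: (parameters_eq1 EK e0 ed) => [|s]; rewrite (mulnC e.+1) ?(mulnC e d) //.
  move=> /andP[es sB]; have [ds|sd] := ltnP d s; first by apply: divA; rewrite ds wE; lia.
  rewrite -bin_sub; last by nia.
  by apply: divA; rewrite wE; nia.
subst d e; have w3 : w = 3 by rewrite wE.
have n6 : n = 6 by rewrite nE wE.
clear hn BK divA nE wE; subst n w.
(* In J(6,3) the code has 20 / 10 words, and each point is in 10 / 10 of them. *)
have C2 : #|C| = 2.
  have := lambda set0; rewrite cards0 => /(_ isT).
  rewrite (_ : nb_containing C set0 = #|C|); last by apply: eq_card => c; rewrite !inE sub0set andbT.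
  by rewrite (_ : 'C(6 - 0, 3 - 0) = 20) //; lia.
have/cards2P[A [B [AB CE]]] : #|C| == 2 by rewrite C2.
split=> //; exists A, B.
have cC c : c \in C -> c \in johnson_vertices 6 3.
  by move=> cC; rewrite inE (codeword_card perfC cC).
split=> //; try by apply: cC; rewrite CE !inE eqxx ?orbT.
apply/pred0P => z /=; apply/negP => /andP[zA zB].
have := lambda [set z]; rewrite cards1 => /(_ isT).
rewrite (_ : nb_containing C [set z] = #|C|).
  by rewrite C2 (_ : 'C(6 - 1, 3 - 1) = 10).
by apply: eq_card => c; rewrite !inE CE !inE sub1set; case: eqP => [->|_]; [|case: eqP => [->|]].
Qed.
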